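(* Let $\mathbb{K}$ be a field of characteristic zero, let $G$ be a finite group, and let $V$ be an $n$-dimensional representation of $G$ over $\mathbb{K}$. Let $J_G$ be the Hilbert ideal for the action of $G$ on $E=\bigwedge(x_1,\dots,x_n)$, and let $I_G=\mathbb{I}'(\mathcal{A}_G)$ be the intersection ideal of the group arrangement $\mathcal{A}_G$ in $\bigwedge(x_1,\dots,x_n,y_1,\dots,y_n)$. Then $$\bigl(I_G+(y_1,\dots,y_n)\bigr)\cap \bigwedge(x_1,\dots,x_n)=J_G .$$
   Context: The elements $x_1,\dots,x_n$ are coordinate functions on $V$, and $x_1,\dots,x_n,y_1,\dots,y_n$ are the corresponding coordinate functions on $V\oplus V$ (the $x_i$ on the first summand, the $y_i$ on the second). $\bigwedge(x_1,\dots,x_n)$ and $\bigwedge(x_1,\dots,x_n,y_1,\dots,y_n)$ denote the exterior algebras over $\mathbb{K}$ on these generators, graded with generators in degree $1$; the first is regarded as a subalgebra of the second. $G$ acts on $E=\bigwedge(x_1,\dots,x_n)$ by the degree-preserving algebra automorphisms induced from its linear action on $V$. Hilbert ideal: $J_G=E\,E_+^G$ is the ideal of $E$ generated by $E_+^G=\{p\in E_+ : g\cdot p=p\text{ for all } g\in G\}$, where $E_+=\bigoplus_{d>0}E_d$. Group arrangement: $\mathcal{A}_G$ is the arrangement of the subspaces $V_g=\{(v,g\cdot v): v\in V\}\subset V\oplus V$, for $g\in G$. If $A(g)=(A(g)_{i,j})$ is the matrix of the action of $g$ on $V$, then $V_g$ is cut out by the linear forms in $S_g=\{\,y_i-\sum_{j=1}^n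 A(g)_{i,j}x_j : i=1,\dots,n\,\}$. The intersection ideal is $\mathbb{I}'(\mathcal{A}_G)=\bigcap_{g\in G}J'_g$, where $J'_g$ is the ideal of $\bigwedge(x_1,\dots,x_n,y_1,\dots,y_n)$ generated by $S_g$. Finally, $(y_1,\dots,y_n)$ denotes the ideal generated by $y_1,\dots,y_n$ in $\bigwedge(x_1,\dots,x_n,y_1,\dots,y_n)$. *)

(* Defs.v *)
From HB Require Import structures.
From mathcomp Require Import all_boot all_order all_algebra all_fingroup.
From mathcomp Require Import mxrepresentation.

Set Implicit Arguments.
Unset Strict Implicit.
Unset Printing Implicit Defensive.

Import GRing.Theory.
Local Open Scope ring_scope.

(* The exterior algebra over K on n generators e_0, ..., e_(n-1), in its       *)
(* monomial basis: p A is the coefficient in p of the product e_A of the e_i,  *)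
(* i in A, taken in increasing order of i.                                     *)
Definition exterior (K : fieldType) (n : nat) : Type := {ffun {set 'I_n} -> K}.

Section ExteriorAlgebra.

Variables (K : fieldType) (n : nat).
Implicit Types (A B C D : {set 'I_n}) (p q r : exterior K n).

HB.instance Definition _ :=
  GRing.Lmodule.copy (exterior K n) {ffun {set 'I_n} -> K^o}.

Definition ninv A B : nat := (\sum_(a in A) \sum_(b in B) (b < a))%N.

(* e_A * e_B = ext_sign A B *: e_(A :|: B) *)
Definition ext_sign A B : K :=
  if [disjoint A & B] then (-1) ^+ ninv A B else 0.

Definition ext_monom A : exterior K n := [ffun C => (C == A)%:R].

Definition ext_one : exterior K n := ext_monom set0.

Definition ext_mul p q : exterior K n :=
  [ffun C => \sum_A \sum_(B | A :|: B == C) ext_sign A B * (p A * q B)].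

Lemma ext_sign0l A : ext_sign set0 A = 1.
Proof. by rewrite /ext_sign -setI_eq0 set0I eqxx /ninv big_set0 expr0. Qed.

Lemma ext_sign0r A : ext_sign A set0 = 1.
Proof.
rewrite /ext_sign -setI_eq0 setI0 eqxx /ninv big1 ?expr0 // => a _.
by rewrite big_set0.
Qed.

Lemma ninvUl A B C : [disjoint A & B] ->
  ninv (A :|: B) C = (ninv A C + ninv B C)%N.
Proof.
by move=> dAB; rewrite /ninv -bigU //=; apply: eq_bigl => i; rewrite !inE.
Qed.

Lemma ninvUr A B C : [disjoint B & C] ->
  ninv A (B :|: C) = (ninv A B + ninv A C)%N.
Proof.
move=> dBC; rewrite /ninv -big_split /=; apply: eq_bigr => a _.
by rewrite -bigU //=; apply: eq_bigl => i; rewrite !inE.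
Qed.

Lemma ext_signA A B C :
  ext_sign A B * ext_sign (A :|: B) C = ext_sign A (B :|: C) * ext_sign B C.
Proof.
rewrite /ext_sign -!setI_eq0 setIUl setIUr !setU_eq0 !setI_eq0.
case dAB: [disjoint A & B]; case dAC: [disjoint A & C];
  case dBC: [disjoint B & C]; rewrite /= ?mul0r ?mulr0 //.
by rewrite ninvUl // ninvUr // -!exprD addnA.
Qed.

Lemma ext_mulA : associative ext_mul.
Proof.
move=> p q r; apply/ffunP => D; rewrite !ffunE.
transitivity (\sum_A \sum_B \sum_(C | A :|: (B :|: C) == D)
    ext_sign A (B :|: C) * ext_sign B C * (p A * (q B * r C))).
  apply: eq_bigr => A _.
  under eq_bigr => X _ do rewrite ffunE big_distrr /= big_distrr /=.
  rewrite exchange_big /=; apply: eq_bigr => B _.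
  under eq_bigr => X _ do rewrite big_distrr /= big_distrr /=.
  rewrite (exchange_big_dep (fun C => A :|: (B :|: C) == D)) /=; last first.
    by move=> X C AX /eqP ->.
  apply: eq_bigr => C /eqP DE.
  rewrite (big_pred1 (B :|: C)) => [|X]; last first.
    by rewrite /= andbC eq_sym; case: eqP => //= ->; rewrite DE eqxx.
  by rewrite -!mulrA; congr (_ * _); rewrite mulrCA.
under [RHS]eq_bigr => X _ do
  under eq_bigr => C _ do rewrite ffunE big_distrl /= big_distrr /=.
under [RHS]eq_bigr => X _ do rewrite exchange_big /=.
rewrite [RHS]exchange_big /=; apply: eq_bigr => A _.
under [RHS]eq_bigr => X _ do
  under eq_bigr => C _ do rewrite big_distrl /= big_distrr /=.
under [RHS]eq_bigr => X _ do rewrite exchange_big /=.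
rewrite [RHS](exchange_big_dep xpredT) //=; apply: eq_bigr => B _.
rewrite [RHS](big_pred1 (A :|: B)) => [|X]; last by rewrite /= eq_sym.
apply: eq_big => [C|C _]; first by rewrite setUA.
by rewrite -ext_signA -!mulrA mulrCA.
Qed.

Lemma ext_mul1l : left_id ext_one ext_mul.
Proof.
move=> p; apply/ffunP => C; rewrite !ffunE (bigD1 set0) //= [X in _ + X]big1 ?addr0.
  rewrite (big_pred1 C) => [|B]; last by rewrite set0U.
  by rewrite ext_sign0l ffunE eqxx !mul1r.
by move=> A /negPf A0; apply: big1 => B _; rewrite ffunE A0 mul0r mulr0.
Qed.

Lemma ext_mul1r : right_id ext_one ext_mul.
Proof.
move=> p; apply/ffunP => C; rewrite !ffunE (bigD1 C) //= [X in _ + X]big1 ?addr0.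
  rewrite (bigD1 set0) ?setU0 //= big1 ?addr0.
    by rewrite ext_sign0r ffunE eqxx mul1r mulr1.
  by move=> B /andP[_ /negPf B0]; rewrite ffunE B0 !mulr0.
move=> A /negPf AC; apply: big1 => B /eqP defC; rewrite ffunE.
case: eqP => [B0|_]; last by rewrite !mulr0.
by rewrite -defC B0 setU0 eqxx in AC.
Qed.

Lemma ext_mulDl : left_distributive ext_mul +%R.
Proof.
move=> p q r; apply/ffunP => C; rewrite !ffunE -big_split; apply: eq_bigr => A _.
by rewrite -big_split; apply: eq_bigr => B _; rewrite ffunE mulrDl mulrDr.
Qed.

Lemma ext_mulDr : right_distributive ext_mul +%R.
Proof.
move=> p q r; apply/ffunP => C; rewrite !ffunE -big_split; apply: eq_bigr => A _.
by rewrite -big_split; apply: eq_bigr => B _; rewrite ffunE !mulrDr.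
Qed.

Lemma ext_one_neq0 : ext_one != 0.
Proof.
by apply/eqP => /ffunP/(_ set0)/eqP; rewrite !ffunE eqxx oner_eq0.
Qed.

HB.instance Definition _ := GRing.Zmodule_isNzRing.Build (exterior K n)
  ext_mulA ext_mul1l ext_mul1r ext_mulDl ext_mulDr ext_one_neq0.

Lemma ext_scaleAl (k : K) p q : k *: (p * q) = k *: p * q.
Proof.
apply/ffunP => C; rewrite !ffunE scaler_sumr; apply: eq_bigr => A _.
rewrite scaler_sumr; apply: eq_bigr => B _.
by rewrite ffunE; apply: etrans (mulrCA _ _ _) _; congr (_ * _); exact: mulrA.
Qed.

HB.instance Definition _ :=
  GRing.Lmodule_isLalgebra.Build K (exterior K n) ext_scaleAl.

Lemma ext_scaleAr (k : K) p q : k *: (p * q) = p * (k *: q).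
Proof.
apply/ffunP => C; rewrite !ffunE scaler_sumr; apply: eq_bigr => A _.
rewrite scaler_sumr; apply: eq_bigr => B _.
by rewrite ffunE; apply: etrans (mulrCA _ _ _) _; congr (_ * _); exact: mulrCA.
Qed.

HB.instance Definition _ :=
  GRing.Lalgebra_isAlgebra.Build K (exterior K n) ext_scaleAr.

Definition ext_gen (i : 'I_n) : exterior K n := ext_monom [set i].

(* The ideal E_+ spanned by the homogeneous elements of positive degree. *)
Definition ext_pos p : Prop := forall A, p A != 0 -> (0 < #|A|)%N.

Lemma ext_monomM A B :
  ext_monom A * ext_monom B = ext_sign A B *: ext_monom (A :|: B).
Proof.
apply/ffunP => C; rewrite !ffunE (bigD1 A) //= [X in _ + X]big1 ?addr0.
  rewrite big_mkcond (bigD1 B) //= [X in _ + X]big1 ?addr0.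
    rewrite !ffunE !eqxx !mulr1 eq_sym -[_ *: _]/(_ * _).
    by case: eqP; rewrite ?mulr1 ?mulr0.
  by move=> B' /negPf B'B; rewrite !ffunE B'B !mulr0 if_same.
by move=> A' /negPf A'A; apply: big1 => B' _; rewrite ffunE A'A mul0r mulr0.
Qed.

(* Extension of f : 'I_n -> S to the algebra morphism sending each generator   *)
(* e_i to f i; see ext_lift_gen and ext_liftM. The product in the possibly     *)
(* noncommutative algebra S runs over A in increasing order.                   *)
Definition ext_lift (S : algType K) (f : 'I_n -> S) (p : exterior K n) : S :=
  \sum_A p A *: \prod_(i in A) f i.

Section Lift.

Variables (S : algType K) (f : 'I_n -> S).

Lemma ext_lift_is_linear : linear (ext_lift f).
Proof.
move=> k p q; rewrite /ext_lift scaler_sumr -big_split; apply: eq_bigr => A _.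
by rewrite !ffunE scalerDl -scalerA.
Qed.

HB.instance Definition _ :=
  GRing.isLinear.Build K (exterior K n) S *:%R (ext_lift f) ext_lift_is_linear.

Lemma ext_lift_monom A : ext_lift f (ext_monom A) = \prod_(i in A) f i.
Proof.
rewrite /ext_lift (bigD1 A) //= [X in _ + X]big1 ?addr0 ?ffunE ?eqxx ?scale1r //.
by move=> B /negPf BA; rewrite ffunE BA scale0r.
Qed.

Lemma ext_lift1 : ext_lift f 1 = 1.
Proof. by rewrite ext_lift_monom big_set0. Qed.

Lemma ext_lift_gen i : ext_lift f (ext_gen i) = f i.
Proof. by rewrite ext_lift_monom big_set1. Qed.

Hypothesis f_sqr : forall i, f i * f i = 0.
Hypothesis f_anti : forall i j, f i * f j = - (f j * f i).

Let insert_prod i B (s : seq 'I_n) :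
    sorted ltn [seq val j | j <- s] -> i \in s ->
  f i * \prod_(j <- s | j \in B) f j =
    if i \in B then 0 else
    (-1) ^+ (\sum_(j <- s | j \in B) (j < i))%N
      *: \prod_(j <- s | j \in i |: B) f j.
Proof.
elim: s => [|j s IHs] //= srt; rewrite inE => ijs.
have lt_j k : k \in s -> (j < k)%N.
  move=> ks; move: srt; rewrite path_sortedE; last exact: ltn_trans.
  by case/andP=> /allP/(_ (val k)) + _; apply; apply: map_f.
have {}IHs := IHs (path_sorted srt).
rewrite !big_cons !inE; case: (eqVneq j i) => [<-{ijs IHs}|neq_ji].
  have [jB|jB] := boolP (j \in B); first by rewrite mulrA f_sqr mul0r.
  have -> : (\sum_(k <- s | k \in B) (k < j))%N = 0%N.
    by rewrite big_seq_cond big1 // => k /andP[/lt_j jk _]; rewrite ltnNge ltnW.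
  rewrite expr0 scale1r; congr (_ * _); rewrite big_seq_cond [RHS]big_seq_cond.
  apply: eq_bigl => k; rewrite !inE; case: eqP => // ->.
  by have [/lt_j|] := boolP (j \in s); rewrite ?ltnn.
have is_ : i \in s by move: ijs; rewrite eq_sym (negPf neq_ji).
have {}IHs := IHs is_; rewrite /= (lt_j i is_).
have [jB|jB] := boolP (j \in B); last exact: IHs.
rewrite mulrA f_anti mulNr -mulrA IHs; case: ifP; first by rewrite mulr0 oppr0.
by rewrite exprD expr1 -scalerA -scalerAr scaleN1r.
Qed.

Let sorted_enum : sorted ltn [seq val j | j <- index_enum 'I_n].
Proof. by rewrite /index_enum -enumT val_enum_ord iota_ltn_sorted. Qed.

Let gen_prod i B :
  f i * \prod_(j in B) f j = ext_sign [set i] B *: \prod_(j in i |: B) f j.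
Proof.
rewrite (insert_prod _ sorted_enum) ?mem_index_enum // /ext_sign disjoints1.
by case: (i \in B); rewrite ?scale0r //= /ninv big_set1.
Qed.

Let prod_prod A B : (\prod_(i in A) f i) * (\prod_(i in B) f i) =
  ext_sign A B *: \prod_(i in A :|: B) f i.
Proof.
suff H s : sorted ltn [seq val j | j <- s] ->
    (\prod_(i <- s | i \in A) f i) * (\prod_(i in B) f i) =
    ext_sign [set i in s | i \in A] B *:
       \prod_(i in [set i in s | i \in A] :|: B) f i.
  rewrite (H _ sorted_enum); do 2?[congr (_ *: _)].
    by congr ext_sign; apply/setP => i; rewrite !inE mem_index_enum.
  by apply: eq_bigl => i; rewrite !inE mem_index_enum.
elim: s => [_|j s IHs srt].
  have -> : [set i in [::] | i \in A] = set0 by apply/setP => i; rewrite !inE.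
  by rewrite big_nil mul1r ext_sign0l scale1r set0U.
rewrite big_cons; have {}IHs := IHs (path_sorted srt).
set A' := [set i in s | i \in A] in IHs *.
have lt_j k : k \in s -> (j < k)%N.
  move=> ks; move: srt; rewrite /= path_sortedE; last exact: ltn_trans.
  by case/andP=> /allP/(_ (val k)) + _; apply; apply: map_f.
have [jA|jA] := boolP (j \in A); last first.
  rewrite IHs; suff -> : [set i in j :: s | i \in A] = A' by [].
  by apply/setP => i; rewrite !inE; case: eqP => // ->; rewrite (negPf jA) !andbF.
have -> : [set i in j :: s | i \in A] = j |: A'.
  by apply/setP => i; rewrite !inE; case: eqP => // ->.
rewrite -mulrA IHs -scalerAr gen_prod scalerA mulrC -ext_signA setUA.
suff -> : ext_sign [set j] A' = 1 by rewrite mul1r.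
rewrite /ext_sign disjoints1 inE; case: andP => [[/lt_j]|_]; rewrite ?ltnn //=.
rewrite /ninv big_set1 big1 // => b; rewrite inE => /andP[/lt_j jb _].
by rewrite ltnNge ltnW.
Qed.

Lemma ext_liftM : {morph ext_lift f : p q / p * q}.
Proof.
move=> p q; rewrite /ext_lift mulr_suml.
transitivity (\sum_C \sum_A \sum_(B | A :|: B == C)
    (ext_sign A B * (p A * q B)) *: \prod_(i in C) f i).
  apply: eq_bigr => C _; rewrite ffunE scaler_suml.
  by apply: eq_bigr => A _; rewrite scaler_suml.
rewrite exchange_big; apply: eq_bigr => A _; rewrite mulr_sumr.
rewrite (exchange_big_dep xpredT) //=; apply: eq_bigr => B _.
rewrite (big_pred1 (A :|: B)) => [|C]; last by rewrite /= eq_sym.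
by rewrite -scalerAl -scalerAr prod_prod !scalerA mulrC.
Qed.

End Lift.

End ExteriorAlgebra.

Arguments ext_gen K {n} i.

(* The two-sided ideal generated by S. *)
Definition ideal_gen (R : nzRingType) (S : R -> Prop) (p : R) : Prop :=
  exists2 s : seq (R * R * R), forall t, t \in s -> S t.1.2 &
    p = \sum_(t <- s) t.1.1 * t.1.2 * t.2.

Definition ideal_add (R : nzRingType) (I J : R -> Prop) (p : R) : Prop :=
  exists a b : R, [/\ I a, J b & p = a + b].

Section GroupArrangement.

(* rG g is the matrix A(g) of g acting on column vectors V = 'cV[K]_n; this is *)
(* a left action because rG (g * h) = rG g *m rG h.                            *)
Variables (K : fieldType) (gT : finGroupType) (G : {group gT}) (n : nat).
Variable rG : mx_representation K G n.

(* (g . x_i)(v) = x_i (g^-1 . v) *)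
Definition ext_act (g : gT) : exterior K n -> exterior K n :=
  ext_lift (fun i => \sum_j rG g^-1%g i j *: ext_gen K j).

Definition pos_invariant (p : exterior K n) : Prop :=
  ext_pos p /\ forall g, g \in G -> ext_act g p = p.

Definition hilbert_ideal : exterior K n -> Prop := ideal_gen pos_invariant.

Definition xgen (i : 'I_n) : exterior K (n + n) := ext_gen K (lshift n i).
Definition ygen (i : 'I_n) : exterior K (n + n) := ext_gen K (rshift n i).

Definition graph_form (g : gT) (i : 'I_n) : exterior K (n + n) :=
  ygen i - \sum_j rG g i j *: xgen j.

Definition graph_ideal (g : gT) : exterior K (n + n) -> Prop :=
  ideal_gen (fun p => exists i, p = graph_form g i).

Definition intersection_ideal (p : exterior K (n + n)) : Prop :=
  forall g, g \in G -> graph_ideal g p.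

End GroupArrangement.

Definition y_ideal (K : fieldType) (n : nat) : exterior K (n + n) -> Prop :=
  ideal_gen (fun p => exists i : 'I_n, p = ygen K i).

(* The embedding by which the exterior algebra on the x_i is regarded as a     *)
(* subalgebra of the one on the x_i and y_i.                                   *)
Definition ext_incl (K : fieldType) (n : nat) :
  exterior K n -> exterior K (n + n) := ext_lift (@xgen K n).

Section ActionIsMorphism.

Variables (K : fieldType) (n : nat).

Lemma ext_gen_sqr (i : 'I_n) : ext_gen K i * ext_gen K i = 0.
Proof. by rewrite ext_monomM /ext_sign disjoints1 inE eqxx scale0r. Qed.

Lemma ext_gen_anti (i j : 'I_n) :
  ext_gen K i * ext_gen K j = - (ext_gen K j * ext_gen K i).
Proof.
case: (eqVneq i j) => [->|neq_ij]; first by rewrite ext_gen_sqr oppr0.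
rewrite !ext_monomM /ext_sign !disjoints1 !inE (eq_sym j) neq_ij setUC.
rewrite /ninv !big_set1 -scaleNr; congr (_ *: _).
by case: (ltngtP i j) neq_ij => [||/val_inj->];
  rewrite ?eqxx ?expr0 ?expr1 ?opprK.
Qed.

Let form (c : 'I_n -> K) := \sum_j c j *: ext_gen K j.

Lemma lin_form_anti c d : form c * form d = - (form d * form c).
Proof.
rewrite /form !mulr_suml -sumrN.
under eq_bigr => i _ do rewrite mulr_sumr.
rewrite exchange_big; apply: eq_bigr => j _; rewrite mulr_sumr -sumrN.
apply: eq_bigr => i _; rewrite -!scalerAl -!scalerAr ext_gen_anti.
by rewrite !scalerN !scalerA mulrC.
Qed.

Lemma lin_form_sqr c : form c * form c = 0.
Proof.
suff [] : form c * form c = 0 /\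
    forall j, form c * ext_gen K j = - (ext_gen K j * form c) by [].
rewrite /form; elim/big_rec: _ => [|i u _ [uu uj]].
  by split=> [|j]; rewrite ?mul0r // mulr0 oppr0.
split=> [|j].
  rewrite mulrDl !mulrDr uu addr0 -!scalerAl -!scalerAr ext_gen_sqr !scaler0.
  by rewrite add0r uj scalerN addrN.
by rewrite mulrDl mulrDr uj opprD -!scalerAl -!scalerAr ext_gen_anti scalerN.
Qed.

Lemma ext_actM (gT : finGroupType) (G : {group gT})
  (rG : mx_representation K G n) g : {morph ext_act rG g : p q / p * q}.
Proof. by apply: ext_liftM => *; [exact: lin_form_sqr|exact: lin_form_anti]. Qed.

End ActionIsMorphism.

Lemma ext_inclM (K : fieldType) (n : nat) : {morph @ext_incl K n : p q / p * q}.
Proof. by apply: ext_liftM => *; [exact: ext_gen_sqr|exact: ext_gen_anti]. Qed.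

(* Main.v *)
Require Import Defs.
From HB Require Import structures.
From mathcomp Require Import all_boot all_order all_algebra all_fingroup.
From mathcomp Require Import mxrepresentation.

(** For a positive-degree invariant [q], the substitution [y_i = sum_j A(g)_ij x_j]
    shows that [q(x) - q(y)] lies in every graph ideal, while [q(y)] lies in
    [(y_1, ..., y_n)]; this gives the inclusion of the Hilbert ideal.
    Conversely, write [a] in the intersection ideal as [sum_A c_A(x) y_A].
    Each substitution kills [a], and summing over the group yields
    [sum_A c_A * T(x_A) = 0] with [T] the transfer.  The terms with [A] nonempty
    lie in the Hilbert ideal and the remaining one is [#|G| * a(x, 0)]; since
    [#|G|] is invertible, [a(x, 0)] lies in the Hilbert ideal. *)

Set Implicit Arguments.
Unset Strict Implicit.
Unset Printing Implicit Defensive.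

Import GRing.Theory.
Local Open Scope ring_scope.

(** * Closure properties of generated two-sided ideals *)

Section IdealGen.

Variables (R : nzRingType) (S : R -> Prop).

Lemma ideal_gen0 : ideal_gen S 0.
Proof. by exists [::] => //; rewrite big_nil. Qed.

Lemma mem_ideal_gen p : S p -> ideal_gen S p.
Proof.
move=> Sp; exists [:: (1, p, 1)] => [t|]; first by rewrite inE => /eqP->.
by rewrite big_seq1 /= mul1r mulr1.
Qed.

Lemma ideal_genD p q : ideal_gen S p -> ideal_gen S q -> ideal_gen S (p + q).
Proof.
move=> [s Ss ->] [t St ->]; exists (s ++ t); last by rewrite big_cat.
by move=> u; rewrite mem_cat => /orP[/Ss|/St].
Qed.

Lemma ideal_genM u v p : ideal_gen S p -> ideal_gen S (u * p * v).
Proof.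
move=> [s Ss ->]; exists [seq (u * t.1.1, t.1.2, t.2 * v) | t <- s].
  by move=> _ /mapP[t /Ss St ->].
rewrite big_map mulr_sumr mulr_suml; apply: eq_bigr => t _ /=.
by rewrite !mulrA.
Qed.

Lemma ideal_genMl u p : ideal_gen S p -> ideal_gen S (u * p).
Proof. by move/(ideal_genM u 1); rewrite mulr1. Qed.

Lemma ideal_genMr v p : ideal_gen S p -> ideal_gen S (p * v).
Proof. by move/(ideal_genM 1 v); rewrite mul1r. Qed.

Lemma ideal_genN p : ideal_gen S p -> ideal_gen S (- p).
Proof. by move/(ideal_genMl (-1)); rewrite mulN1r. Qed.

Lemma ideal_gen_sum (I : Type) (r : seq I) (P : pred I) (F : I -> R) :
  (forall i, P i -> ideal_gen S (F i)) -> ideal_gen S (\sum_(i <- r | P i) F i).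
Proof.
by move=> SF; apply: big_ind => //; [exact: ideal_gen0 | exact: ideal_genD].
Qed.

Lemma ideal_gen_morph0 (R' : nzRingType) (f : {additive R -> R'}) p :
    {morph f : u v / u * v} -> (forall q, S q -> f q = 0) ->
  ideal_gen S p -> f p = 0.
Proof.
move=> fM fS [s Ss ->]; rewrite raddf_sum big_seq big1 // => t ts.
by rewrite !fM (fS _ (Ss t ts)) mulr0 mul0r.
Qed.

End IdealGen.

Lemma ideal_genZ (K : fieldType) (R : algType K) (S : R -> Prop) k p :
  ideal_gen S p -> ideal_gen S (k *: p).
Proof. by move/(ideal_genMl k%:A); rewrite mulr_algl. Qed.

Lemma ideal_add_sum (R : nzRingType) (I J : R -> Prop) (T : eqType)
    (s : seq T) (F : T -> R) :
    I 0 -> J 0 -> (forall a b, I a -> I b -> I (a + b)) ->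
    (forall a b, J a -> J b -> J (a + b)) ->
  (forall t, t \in s -> ideal_add I J (F t)) ->
  ideal_add I J (\sum_(t <- s) F t).
Proof.
move=> I0 J0 ID JD IJF; rewrite big_seq.
apply: big_ind => [|x y [a [b [Ia Jb ->]]] [c [d [Ic Jd ->]]]|//].
  by exists 0, 0; rewrite addr0.
by exists (a + c), (b + d); split; [exact: ID | exact: JD | rewrite addrACA].
Qed.

Lemma prodr_seq_eq0 (R : nzRingType) (I : eqType) (r : seq I) (P : pred I)
    (F : I -> R) i :
  i \in r -> P i -> F i = 0 -> \prod_(j <- r | P j) F j = 0.
Proof.
move=> ir Pi Fi; case/splitPr: ir => r1 r2.
by rewrite big_cat big_cons Pi Fi /= mul0r mulr0.
Qed.

(** * Monomials and algebra morphisms out of an exterior algebra *)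

Section Exterior.

Variables (K : fieldType) (n : nat).
Implicit Types (p q : exterior K n) (A : {set 'I_n}).

Lemma ext_monom_sum p : p = \sum_A p A *: ext_monom K A.
Proof.
apply/ffunP => C; rewrite sum_ffunE (bigD1 C) //= big1 ?addr0 => [|A AC].
  by rewrite !ffunE eqxx; exact: (esym (mulr1 _)).
by rewrite !ffunE eq_sym (negPf AC); exact: mulr0.
Qed.

Lemma ext_posP p : ext_pos p <-> p set0 = 0.
Proof.
split=> [pp|p0 A]; last first.
  by rewrite card_gt0; apply: contraNneq => ->; rewrite p0.
by apply/eqP; apply: contraT => /pp; rewrite cards0.
Qed.

(** Multiplying in increasing order creates no inversion, so every sign is 1. The induction runs
    over an arbitrary increasing list of indices. *)
Lemma ext_gen_prod A : \prod_(i in A) ext_gen K i = ext_monom K A.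
Proof.
suff H s : sorted ltn [seq val j | j <- s] ->
    \prod_(i <- s | i \in A) ext_gen K i = ext_monom K [set i in s | i \in A].
  rewrite H; last by rewrite /index_enum -enumT val_enum_ord iota_ltn_sorted.
  by congr ext_monom; apply/setP => i; rewrite !inE mem_index_enum.
elim: s => [_|j s IHs srt].
  by rewrite big_nil; congr ext_monom; apply/setP => i; rewrite !inE.
have lt_j k : k \in s -> (j < k)%N.
  move=> ks; move: srt; rewrite /= path_sortedE; last exact: ltn_trans.
  by case/andP=> /allP/(_ (val k)) + _; apply; apply: map_f.
rewrite big_cons IHs ?(path_sorted srt) //.
have [jA|jA] := boolP (j \in A); last first.
  congr ext_monom; apply/setP => i; rewrite !inE.
  by case: eqP => // ->; rewrite (negPf jA) !andbF.
rewrite ext_monomM /ext_sign disjoints1 inE.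
case: andP => [[/lt_j]|_]; rewrite ?ltnn //=.
rewrite /ninv big_set1 big1 ?scale1r => [|b].
  by congr ext_monom; apply/setP => i; rewrite !inE; case: eqP => // ->.
by rewrite inE => /andP[/lt_j jb _]; rewrite ltnNge ltnW.
Qed.

Lemma eq_ext_lift (S : algType K) (f h : 'I_n -> S) :
  f =1 h -> ext_lift f =1 ext_lift h.
Proof.
move=> fh p; apply: eq_bigr => A _; congr (_ *: _).
by apply: eq_bigr => i _; apply: fh.
Qed.

(** The relations on [f] make the outer lift multiplicative, so it passes through the ordered
    products that define the inner one. *)
Lemma ext_lift_comp m (S : algType K) (f : 'I_m -> S)
    (h : 'I_n -> exterior K m) p :
    (forall i, f i * f i = 0) -> (forall i j, f i * f j = - (f j * f i)) ->
  ext_lift f (ext_lift h p) = ext_lift (fun i => ext_lift f (h i)) p.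
Proof.
move=> f2 fN; rewrite [ext_lift h p]/ext_lift linear_sum.
apply: eq_bigr => A _; rewrite linearZ; congr (_ *: _).
exact: (big_morph _ (ext_liftM f2 fN) (ext_lift1 f)).
Qed.

Lemma ext_lift0 (S : algType K) p : ext_lift (fun=> 0 : S) p = p set0 *: 1.
Proof.
rewrite /ext_lift (bigD1 set0) //= big_set0 big1 ?addr0 // => A /set0Pn[i iA].
by rewrite (prodr_seq_eq0 (mem_index_enum i)) ?scaler0.
Qed.

(** Ordered products are compared one factor at a time, by [f u - h v = (f - h) u + h (u - v)]. *)
Lemma ext_lift_congr (R : algType K) (S : R -> Prop) (f h : 'I_n -> R) p :
    (forall i, ideal_gen S (f i - h i)) ->
  ideal_gen S (ext_lift f p - ext_lift h p).
Proof.
move=> Sfh; rewrite /ext_lift -sumrB; apply: ideal_gen_sum => A _.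
rewrite -scalerBr; apply: ideal_genZ.
apply: (big_rec2 (fun u v => ideal_gen S (u - v))) => [|i u v _ Suv].
  by rewrite subrr; apply: ideal_gen0.
have -> : f i * u - h i * v = (f i - h i) * u + h i * (u - v).
  by rewrite mulrBl mulrBr addrA subrK.
by apply: ideal_genD; [apply: ideal_genMr | apply: ideal_genMl].
Qed.

End Exterior.

(** * Linear substitutions *)

(** Rectangular matrices let one notion cover the group action, the inclusion of the [x]-algebra
    ([row_mx 1%:M 0]) and the substitution [x := x], [y := B x] ([col_mx 1%:M B]). *)
Definition ext_lin (K : fieldType) (m n : nat) (A : 'M[K]_(m, n)) :
    exterior K m -> exterior K n :=
  ext_lift (fun i => \sum_j A i j *: ext_gen K j).

Section LinearSubstitution.

Variable K : fieldType.

HB.instance Definition _ m n (A : 'M[K]_(m, n)) :=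
  GRing.Linear.on (@ext_lin K m n A).

Lemma ext_linM m n (A : 'M[K]_(m, n)) : {morph ext_lin A : p q / p * q}.
Proof. by apply: ext_liftM => *; [apply: lin_form_sqr | apply: lin_form_anti]. Qed.

Lemma ext_lin_gen m n (A : 'M[K]_(m, n)) i :
  ext_lin A (ext_gen K i) = \sum_j A i j *: ext_gen K j.
Proof. exact: ext_lift_gen. Qed.

(** Generator [i] goes to row [i] of the matrix, hence the reversed order of the product. *)
Lemma ext_lin_comp m n r (A : 'M[K]_(m, n)) (B : 'M[K]_(n, r)) p :
  ext_lin B (ext_lin A p) = ext_lin (A *m B) p.
Proof.
rewrite [LHS]ext_lift_comp => [|*|*]; [|exact: lin_form_sqr|exact: lin_form_anti].
apply: eq_ext_lift => i; rewrite linear_sum.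
under eq_bigr => j _ do rewrite linearZ /= ext_lift_gen scaler_sumr.
rewrite exchange_big; apply: eq_bigr => k _; rewrite mxE scaler_suml.
by apply: eq_bigr => j _; rewrite scalerA.
Qed.

Lemma sum_scalar1_gen n (i : 'I_n) :
  \sum_j (1%:M : 'M[K]_n) i j *: ext_gen K j = ext_gen K i.
Proof.
rewrite (bigD1 i) //= mxE eqxx scale1r big1 ?addr0 // => j ji.
by rewrite mxE eq_sym (negPf ji) scale0r.
Qed.

Lemma ext_lin1 n (p : exterior K n) : ext_lin 1%:M p = p.
Proof.
rewrite [RHS]ext_monom_sum; apply: eq_bigr => A _; rewrite -ext_gen_prod.
by congr (_ *: _); apply: eq_bigr => i _; apply: sum_scalar1_gen.
Qed.

Lemma ext_lin_monom0 m n (A : 'M[K]_(m, n)) : ext_lin A (ext_monom K set0) = 1.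
Proof. exact: ext_lift1. Qed.

Lemma ext_lin0 m n p : ext_lin (0 : 'M[K]_(m, n)) p = p set0 *: 1.
Proof.
rewrite -ext_lift0; apply: eq_ext_lift => i.
by apply: big1 => j _; rewrite mxE scale0r.
Qed.

(** The constant term is read off by substituting the zero matrix, which absorbs [A]. *)
Lemma ext_lin_coef0 m n (A : 'M[K]_(m, n)) p : ext_lin A p set0 = p set0.
Proof.
have: ext_lin (0 : 'M_(n, n)) (ext_lin A p) = ext_lin 0 p.
  by rewrite ext_lin_comp mulmx0.
rewrite !ext_lin0 => /ffunP/(_ set0).
by rewrite !ffunE eqxx; rewrite -![_ *: 1%R]/(_ * 1) !mulr1.
Qed.

(** All left indices precede the right ones, so a monomial splits into its two parts without a
    sign. *)
Lemma ext_lin_col_mx_monom m1 m2 n (A : 'M[K]_(m1, n)) (B : 'M[K]_(m2, n))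
    (C : {set 'I_(m1 + m2)}) :
  ext_lin (col_mx A B) (ext_monom K C) =
    ext_lin A (ext_monom K (lshift m2 @^-1: C)) *
    ext_lin B (ext_monom K (@rshift m1 m2 @^-1: C)).
Proof.
rewrite /ext_lin !ext_lift_monom big_split_ord; congr (_ * _).
  apply: eq_big => i; first by rewrite inE.
  by move=> _; apply: eq_bigr => j _; rewrite col_mxEu.
apply: eq_big => i; first by rewrite inE.
by move=> _; apply: eq_bigr => j _; rewrite col_mxEd.
Qed.

Lemma ext_inclE n (p : exterior K n) : ext_incl p = ext_lin (row_mx 1%:M 0) p.
Proof.
apply: eq_ext_lift => i; rewrite big_split_ord /= [X in _ + X]big1 ?addr0.
  rewrite (bigD1 i) //= row_mxEl mxE eqxx scale1r big1 ?addr0 // => j ji.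
  by rewrite row_mxEl mxE eq_sym (negPf ji) scale0r.
by move=> j _; rewrite row_mxEr mxE scale0r.
Qed.

Lemma ext_lin_col_mx_incl n r (B : 'M[K]_(n, r)) (A : 'M[K]_(n, r)) p :
  ext_lin (col_mx A B) (ext_incl p) = ext_lin A p.
Proof. by rewrite ext_inclE ext_lin_comp mul_row_col mul1mx mul0mx addr0. Qed.

Lemma ext_lin_graph_form0 n (B : 'M[K]_n) i :
  ext_lin (col_mx 1%:M B) (ygen K i - \sum_j B i j *: xgen K j) = 0.
Proof.
apply/eqP; rewrite linearB /= subr_eq0 ext_lin_gen linear_sum; apply/eqP.
apply: eq_bigr => j _; rewrite linearZ /= col_mxEd; congr (_ *: _).
rewrite ext_lin_gen -[LHS]sum_scalar1_gen.
by apply: eq_bigr => k _; rewrite col_mxEu.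
Qed.

End LinearSubstitution.

(** * Transfer and the two inclusions *)

Section HilbertIdeal.

Variables (K : fieldType) (gT : finGroupType) (G : {group gT}) (n : nat).
Variable rG : mx_representation K G n.
Implicit Types p q : exterior K n.

Definition transfer p := \sum_(g in G) ext_lin (rG g) p.

(** Acting by [g] turns the summand of [h] into that of [h * g^-1], which only permutes the sum;
    substitutions preserve the vanishing constant term. *)
Lemma transfer_pos_invariant p : ext_pos p -> pos_invariant rG (transfer p).
Proof.
move/ext_posP => p0; split.
  apply/ext_posP; rewrite sum_ffunE big1 // => g _.
  by rewrite ext_lin_coef0.
move=> g Gg; rewrite /transfer -[ext_act rG g]/(ext_lin (rG g^-1%g)) linear_sum.
rewrite [RHS](reindex_inj (mulIg g^-1%g)) /=.
apply: eq_big => h; first by rewrite groupMr ?groupV.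
by move=> Gh; rewrite ext_lin_comp repr_mxM ?groupV.
Qed.

(** By linearity [a] may be a monomial. Its [x]-part is a common left factor, which leaves the
    transfer of its [y]-part to compare with [#|G|] times the value at [y = 0]. *)
Lemma sum_graph_subst_mod_hilbert (a : exterior K (n + n)) :
  hilbert_ideal rG (\sum_(g in G) ext_lin (col_mx 1%:M (rG g)) a
                    - #|G|%:R *: ext_lin (col_mx 1%:M 0) a).
Proof.
rewrite [a]ext_monom_sum.
under eq_bigr => g _ do rewrite linear_sum.
rewrite exchange_big (linear_sum (ext_lin (col_mx 1%:M 0))) scaler_sumr -sumrB.
apply: ideal_gen_sum => C _ /=.
under eq_bigr => g _ do rewrite linearZ /=.
rewrite [ext_lin _ _]linearZ /= -scaler_sumr scalerA mulrC -scalerA -scalerBr.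
apply: ideal_genZ.
under eq_bigr => g _ do rewrite ext_lin_col_mx_monom.
rewrite ext_lin_col_mx_monom -mulr_sumr scalerAr -mulrBr; apply: ideal_genMl.
(* [A] is the set of [y]-indices. If it is empty, the two terms cancel; otherwise [y = 0] kills the
   second and the first is a positive-degree invariant. *)
set A := _ @^-1: C; have [->|A0] := eqVneq A set0.
  under eq_bigr => g _ do rewrite ext_lin_monom0.
  by rewrite ext_lin_monom0 sumr_const scaler_nat subrr; apply: ideal_gen0.
have A00 : ext_monom K A set0 = 0 by rewrite ffunE eq_sym (negPf A0).
rewrite ext_lin0 A00 scale0r scaler0 subr0.
by apply/mem_ideal_gen/transfer_pos_invariant/ext_posP.
Qed.

Lemma intersection_add_y_sub_hilbert p : #|G|%:R != 0 :> K ->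
  ideal_add (intersection_ideal rG) (@y_ideal K n) (ext_incl p) ->
  hilbert_ideal rG p.
Proof.
move=> nzG [a [b [Ia yb pab]]].
have a_g g : g \in G -> ext_lin (col_mx 1%:M (rG g)) a = 0.
  move/Ia; apply: ideal_gen_morph0; first exact: ext_linM.
  by move=> _ [i ->]; apply: ext_lin_graph_form0.
have b0 : ext_lin (col_mx 1%:M 0) b = 0.
  move: yb; apply: ideal_gen_morph0; first exact: ext_linM.
  move=> _ [i ->] /=; rewrite ext_lin_gen big1 // => j _.
  by rewrite col_mxEd mxE scale0r.
(* Setting [y = 0] in [p = a + b] fixes [p] and kills [b]. *)
have pE : ext_lin (col_mx 1%:M 0) a = p.
  rewrite -[RHS]ext_lin1 -(ext_lin_col_mx_incl 0 1%:M) pab linearD /= b0.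
  exact/esym/addr0.
have := sum_graph_subst_mod_hilbert a; rewrite big1 // sub0r pE.
move/ideal_genN; rewrite opprK => /(ideal_genZ #|G|%:R^-1).
by rewrite scalerA mulVf // scale1r.
Qed.

Lemma invariant_sub_graph_ideal q g : g \in G -> pos_invariant rG q ->
  graph_ideal rG g (ext_incl q - ext_lift (@ygen K n) q).
Proof.
move=> Gg [_ qG].
have -> : ext_incl q = ext_lift (fun i => \sum_j rG g i j *: xgen K j) q.
  (* The action of [g^-1] substitutes [rG g], the matrix occurring in the graph forms of [g]; so
     invariance is used at [g^-1]. *)
  rewrite -{1}[q](qG g^-1%g) ?groupV // /ext_incl ext_lift_comp.
  - apply: eq_ext_lift => i; rewrite linear_sum; apply: eq_bigr => j _.
    by rewrite linearZ /= ext_lift_gen invgK.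
  - by move=> i; apply: ext_gen_sqr.
  - by move=> i j; apply: ext_gen_anti.
rewrite -opprB; apply/ideal_genN/ext_lift_congr => i.
by apply: mem_ideal_gen; exists i.
Qed.

(** Modulo the ideal each [y_i] is congruent to 0, so [q(y)] is congruent to the constant term
    [q(0) = 0]. *)
Lemma pos_y_ideal q : ext_pos q -> y_ideal (ext_lift (@ygen K n) q).
Proof.
move/ext_posP => q0.
have -> : ext_lift (@ygen K n) q =
    ext_lift (@ygen K n) q - ext_lift (fun=> 0) q.
  by rewrite ext_lift0 q0 scale0r subr0.
by apply: ext_lift_congr => i; rewrite subr0; apply: mem_ideal_gen; exists i.
Qed.

Lemma hilbert_sub_intersection_add_y p : hilbert_ideal rG p ->
  ideal_add (intersection_ideal rG) (@y_ideal K n) (ext_incl p).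
Proof.
move=> [s sG ->]; rewrite /ext_incl linear_sum; apply: ideal_add_sum.
- by move=> g _; apply: ideal_gen0.
- exact: ideal_gen0.
- by move=> a b Ia Ib g Gg; apply: ideal_genD; [apply: Ia | apply: Ib].
- exact: ideal_genD.
move=> t /sG; rewrite -[X in ideal_add _ _ X]/(ext_incl _) !ext_inclM.
set q := t.1.2 => tG.
(* Each summand is split along [q(x) = (q(x) - q(y)) + q(y)], keeping its outer factors. *)
exists (ext_incl t.1.1 * (ext_incl q - ext_lift (@ygen K n) q) * ext_incl t.2).
exists (ext_incl t.1.1 * ext_lift (@ygen K n) q * ext_incl t.2); split.
- by move=> g Gg; apply/ideal_genM/invariant_sub_graph_ideal.
- by apply/ideal_genM/pos_y_ideal; case: tG.
- by rewrite -mulrDl -mulrDr subrK.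
Qed.

End HilbertIdeal.

Theorem theorem20 (K : fieldType) (charK0 : [pchar K]%R =i pred0)
    (gT : finGroupType) (G : {group gT}) (n : nat)
    (rG : mx_representation K G n) (p : exterior K n) :
  ideal_add (intersection_ideal rG) (@y_ideal K n) (ext_incl p)
    <-> hilbert_ideal rG p.
Proof.
split; last exact: hilbert_sub_intersection_add_y.
apply: intersection_add_y_sub_hilbert.
(* In characteristic zero the positive integer [#|G|] stays nonzero in [K]. *)
by have /pcharf0P-> := charK0; rewrite -lt0n cardG_gt0.
Qed.
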